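(* Any chordal graph $G$ has $G^2$-connected medians; that is, for every profile $\pi$ on $G$, the median set $\mathrm{Med}(\pi)$ induces a connected subgraph of $G^2$.
   Context: Graphs are undirected, connected, without loops or multiple edges, and not necessarily finite. $d$ is the standard graph distance of $G=(V,E)$. $G^2$ has vertex set $V$, and distinct $u,v$ are adjacent iff $d(u,v)\le 2$. A profile is a map $\pi:V\to[0,\infty)$ with finite support, $F_\pi(x)=\sum_{u}\pi(u)d(u,x)$, and $\mathrm{Med}(\pi)$ is the set of vertices minimizing $F_\pi$. A graph is chordal if every induced cycle has length 3. *)

(* Defs.v *)
From HB Require Import structures.
From mathcomp Require Import all_boot all_order all_algebra.
From mathcomp Require Import boolp classical_sets functions cardinality fsbigop.
From mathcomp Require Import reals.

Set Implicit Arguments.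
Unset Strict Implicit.
Unset Printing Implicit Defensive.

Import Order.TTheory GRing.Theory Num.Theory.

Local Open Scope classical_set_scope.
Local Open Scope ring_scope.

(* The subgraph of (V, e) induced by A is connected; as usual the null graph
   does not count as connected. *)
Definition induces_connected (V : choiceType) (e : rel V) (A : set V) : Prop :=
  A !=set0 /\
  forall x y, A x -> A y ->
    exists p : seq V,
      [/\ path e x p, last x p = y & forall z, z \in p -> A z].

(* V may be infinite. *)
Record graph (V : choiceType) := Graph {
  adj :> rel V;
  adj_sym : symmetric adj;
  adj_irr : irreflexive adj;
  adj_connected : induces_connected adj [set: V]
}.

Section Graph.
Variables (V : choiceType) (G : graph V).

Definition has_walk (x y : V) (n : nat) : Prop :=
  exists p : seq V, [/\ path G x p, last x p = y & size p = n].

Lemma has_walk_ex (x y : V) : exists n, `[< has_walk x y n >].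
Proof.
have [_ /(_ x y I I) [p [xp yp _]]] := adj_connected G.
by exists (size p); apply/asboolP; exists p.
Qed.

Definition dist (x y : V) : nat := ex_minn (has_walk_ex x y).

Definition square : rel V := fun u v => (u != v) && (dist u v <= 2)%N.

Definition induced_cycle (c : seq V) : Prop :=
  [/\ (3 <= size c)%N, ucycle G c &
      {in c &, forall x y, G x y -> y = next c x \/ x = next c y}].

Definition chordal : Prop := forall c, induced_cycle c -> size c = 3%N.

End Graph.

Section Median.
Variables (R : realType) (V : choiceType).

Record profile := Profile {
  weight :> V -> R;
  weight_ge0 : forall u, 0 <= weight u;
  weight_fin : finite_set [set u | weight u != 0]
}.

Variables (G : graph V) (pi : profile).

(* The sum over the possibly infinite V is the sum over the finite support of
   its general term. *)
Definition F (x : V) : R := \sum_(u \in [set: V]) (pi u * (dist G u x)%:R).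

Definition Med : set V := [set x | forall y, F x <= F y].

End Median.

Definition square_connected_medians
    (R : realType) (V : choiceType) (G : graph V) : Prop :=
  forall pi : profile R V, induces_connected (square G) (Med G pi).

(* Main.v *)
Require Import Defs.
From mathcomp Require Import all_boot all_order all_algebra zify.
From mathcomp Require Import boolp classical_sets functions cardinality fsbigop.
From mathcomp Require Import reals.

(** The median set is nonempty: only finitely many vertices carry weight, and a
    vertex whose value of [F] does not exceed a given one has bounded distances
    to them, so only finitely many vectors of distances compete.

    For connectedness, suppose that [u] and [v] are medians at distance
    [k >= 3]. It is enough to find neighbors [w] of [u] and [p] of [v], both on
    geodesics between [u] and [v], such that
    [d(w,x) + d(p,x) <= d(u,x) + d(v,x)] for each [x] of positive weight: then
    [F w + F p <= F u + F v], so [w] is again a median, adjacent to [u] and at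
    distance [k - 1] from [v], and induction on [k] finishes ([Med_step]).

    The inequality can only fail, up to exchanging the two sides, when
    [d(w,x) = d(u,x) + 1] and [d(p,x) >= d(v,x)]. Moving from [u] to [w] then
    approaches [v] and recedes from [x], and in a chordal graph this forces
    [d(v,x) >= d(u,x) + k - 1] ([chordal_edge_separates]). For such an [x], if
    [p] is not closer to [x] than [v] is, then a ladder of triangles along a
    geodesic from [p] to [u] produces a neighbor [s] of [u], one step closer to
    [v], with [d(s,x) = d(u,x)] ([chordal_ladder]). So it suffices that [p] lie
    on a geodesic from such a neighbor to [v], because then
    [d(p,x) <= d(u,x) + k - 2]. One [p] serves finitely many [x]: two crossing
    edges between consecutive spheres around [v] have a diagonal
    ([chordal_crossing]), hence a vertex at distance [2] from [u] can be adjacent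
    to a suitable [s] for every [x] at once ([chordal_common_descent]). The
    hypothesis [k >= 3] leaves room for [p] between that vertex and [v].

    Every use of chordality goes through [chordal_common_neighbor]: an edge of a
    closed walk that does not return to the ends of this edge forms a triangle
    with another vertex of the walk. *)

Set Implicit Arguments.
Unset Strict Implicit.
Unset Printing Implicit Defensive.

Import Order.TTheory GRing.Theory Num.Theory.

(** * Distances and geodesics *)

Section Distance.
Variables (V : choiceType) (G : graph V).
Implicit Types (x y z : V) (p : seq V).

Lemma geodesic x y :
  exists p, [/\ path G x p, last x p = y & size p = dist G x y].
Proof. by rewrite /dist; case: ex_minnP => m /asboolP. Qed.

Lemma dist_le_size x p : path G x p -> dist G x (last x p) <= size p.
Proof.
move=> xp; rewrite /dist; case: ex_minnP => m _; apply.
by apply/asboolP; exists p.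
Qed.

Lemma distxx x : dist G x x = 0.
Proof. by have := @dist_le_size x [::] isT; rewrite leqn0 => /eqP. Qed.

Lemma dist_eq0 x y : dist G x y = 0 -> x = y.
Proof. by case: (geodesic x y) => p [_ <- <-] /size0nil ->. Qed.

Lemma dist_sym x y : dist G x y = dist G y x.
Proof.
suff le a b : dist G a b <= dist G b a by apply/eqP; rewrite eqn_leq !le.
have [p [bp <- <-]] := geodesic b a.
have ap : path G (last b p) (rev (belast b p)).
  rewrite rev_path; under eq_path do rewrite adj_sym; exact: bp.
have lasta : last (last b p) (rev (belast b p)) = b.
  by case: (p) => //= c q; rewrite rev_cons last_rcons.
by have := dist_le_size ap; rewrite lasta size_rev size_belast.
Qed.

Lemma dist_triangle y x z : dist G x z <= dist G x y + dist G y z.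
Proof.
have [p [xp py <-]] := geodesic x y; have [q [yq <- <-]] := geodesic y z.
by rewrite -size_cat -[y]py -last_cat dist_le_size // cat_path xp py.
Qed.

Lemma dist_adj x y : G x y -> dist G x y = 1.
Proof.
move=> xy; have := @dist_le_size x [:: y]; rewrite /= xy => /(_ isT).
case E: (dist G x y) => [|[]] //.
by move/dist_eq0: E xy => ->; rewrite adj_irr.
Qed.

Lemma dist_adj_le x y z :
  G x y -> dist G x z <= (dist G y z).+1 /\ dist G y z <= (dist G x z).+1.
Proof.
move=> xy; have := dist_triangle y x z; have := dist_triangle x y z.
by rewrite [dist G y x]dist_sym (dist_adj xy); lia.
Qed.

Lemma geodesic_mem x p z : path G x p -> size p = dist G x (last x p) ->
  z \in p -> z != x /\ dist G x z + dist G z (last x p) = size p.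
Proof.
move=> xp sp zp; case/splitPr: zp xp sp => p1 p2.
rewrite cat_path last_cat /= => /and3P[xp1 p1z zp2] sp.
have h1 : dist G x z <= (size p1).+1.
  have := @dist_le_size x (rcons p1 z).
  by rewrite rcons_path xp1 p1z last_rcons size_rcons; apply.
have h2 := dist_le_size zp2.
have := dist_triangle z x (last z p2); rewrite size_cat /= in sp *.
(* The case analysis has retyped the sequences over the underlying [eqType]. *)
change (Equality.sort V) with (Choice.sort V) in *.
split; last by lia.
by apply/eqP => zx; rewrite zx in h2 sp; lia.
Qed.

Lemma dist_step x y n : dist G x y = n.+1 -> exists2 z, G x z & dist G z y = n.
Proof.
move=> xyn; case: (geodesic x y) => -[[_ _ /=]|z p [/= /andP[xz zp] py sp]].
  by rewrite xyn.
exists z => //; have := dist_le_size zp; rewrite py.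
by have [] := dist_adj_le y xz; lia.
Qed.

(** Go from [y] to [x] and on to [z] along geodesics. *)
Lemma walk_below x y z n : dist G y x <= n -> dist G z x <= n ->
  exists p, [/\ path G y p, last y p = z &
    {in p, forall t, t = z \/ dist G t x < n}].
Proof.
move=> yn zn; have [p [yp px sp]] := geodesic y x.
have [q [xq qz sq]] := geodesic x z.
exists (p ++ q); split; rewrite ?cat_path ?last_cat ?px ?yp //.
move=> t; rewrite mem_cat => /orP[tp|tq].
  have := geodesic_mem yp; rewrite px => /(_ _ sp tp)[ty dt].
  right; case: (posnP (dist G y t)) => [/dist_eq0 yt|]; last by lia.
  by rewrite yt eqxx in ty.
have := geodesic_mem xq; rewrite qz => /(_ _ sq tq)[_ dt].
case: (posnP (dist G t z)) => [/dist_eq0|tz]; first by left.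
by right; rewrite [dist G t x]dist_sym; rewrite dist_sym in zn; lia.
Qed.

End Distance.

(** * Triangles on the edges of closed walks *)

Section InducedCycle.
Variables (V : choiceType) (G : graph V).
Implicit Types (x y : V) (p q : seq V).

Lemma last_take (T : Type) (x0 a : T) (s : seq T) i :
  i <= size s -> last a (take i s) = nth x0 (a :: s) i.
Proof. by case: i => [|i] si; rewrite ?take0 // (take_nth x0) // last_rcons. Qed.

Lemma path_take x p i : path G x p -> path G x (take i p).
Proof. by rewrite -{1}(cat_take_drop i p) cat_path => /andP[]. Qed.

(** Among the walks from [a] to a neighbor of [c] that stay inside [p], a
    shortest one closes up with [c] to an induced cycle, since a chord would
    shorten it. Chordality leaves only the triangle. *)
Lemma chordal_common_neighbor c a p : chordal G ->
  G c a -> path G a p -> G c (last a p) -> a \notin p -> c \notin p ->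
  p != [::] -> exists t, [/\ t \in p, G a t & G c t].
Proof.
move=> chG ca ap cp aNp cNp p0; apply: contrapT => noT.
pose ok q := [/\ path G a q, G c (last a q), uniq q, {subset q <= p} & q != [::]].
have ex : exists n, `[< exists2 q, ok q & size q = n >].
  have la : last a p != a.
    apply: contraNneq aNp => <-.
    by case: p p0 {ap cp cNp noT ok} => //= b r _; rewrite mem_last.
  case/shortenP: ap cp la => q aq /= /andP[_ uq] qp cq la.
  exists (size q); apply/asboolP; exists q => //; split=> //.
  by apply: contraNneq la => ->.
have [q [aq cq uq qp q0] minq] : exists2 q, ok q &
    forall q', ok q' -> size q <= size q'.
  case: (ex_minnP ex) => n /asboolP[q okq <-] minn; exists q => // q' okq'.
  by apply: minn; apply/asboolP; exists q'.
have aNq : a \notin q by apply: contra aNp => /qp.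
have cNq : c \notin q by apply: contra cNp => /qp.
have ac : c != a by apply: contraTneq ca => ->; rewrite adj_irr.
have us : uniq [:: c, a & q] by rewrite /= inE negb_or ac cNq aNq uq.
have chord i j : i < j -> j < (size q).+2 ->
    G (nth c [:: c, a & q] i) (nth c [:: c, a & q] j) ->
    j = i.+1 \/ i = 0 /\ j = (size q).+1.
  case: i j => [|i] [|[|j]] //= ij jq Gij; first by left.
    (* A chord from [c] ends the walk early. *)
    case: (ltnP j.+1 (size q)) => jq'; last by right; split=> //; clear -jq jq'; lia.
    have := minq (take j.+1 q); rewrite size_takel; last exact: ltnW.
    suff okt : ok (take j.+1 q) by move/(_ okt); rewrite leqNgt jq'.
    split; rewrite ?path_take ?take_uniq //.
    - by rewrite (last_take c) // ltnW.
    - by move=> t /mem_take/qp.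
    - by rewrite -size_eq0 size_takel // ltnW.
  (* A chord between two vertices of the walk is a short cut. *)
  case: (ltnP i j) => ij'; last by left; clear -ij ij'; lia.
  have iq : i <= size q by clear -ij' jq; lia.
  have := minq (take i q ++ drop j q).
  rewrite size_cat size_drop size_takel //.
  suff okt : ok (take i q ++ drop j q).
    by move/(_ okt); clear -ij' jq; lia.
  have dropj : drop j q = nth c q j :: drop j.+1 q by rewrite (drop_nth c).
  split.
  - rewrite cat_path path_take // dropj /= (last_take c) // Gij /=.
    by move: aq; rewrite -{1}(cat_take_drop j q) cat_path dropj /= => /and3P[].
  - by move: cq; rewrite -{1}(cat_take_drop j q) !last_cat dropj.
  - apply: subseq_uniq uq; rewrite -{3}(cat_take_drop i q) cat_subseq //.
    by rewrite -(subnK (ltnW ij')) -drop_drop drop_subseq.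
  - by move=> t; rewrite mem_cat => /orP[/mem_take/qp|/mem_drop/qp].
  - by rewrite dropj; case: (take i q).
have cyc : induced_cycle G [:: c, a & q].
  split=> //.
    by case: (q) q0.
    by rewrite /ucycle us /= ca rcons_path aq adj_sym cq.
  have nextE i : i < (size q).+2 ->
      next [:: c, a & q] (nth c [:: c, a & q] i) = nth c (a :: q) i.
    by move=> iq; rewrite next_nth mem_nth // index_uniq.
  have main i j : i < j -> j < (size q).+2 ->
      G (nth c [:: c, a & q] i) (nth c [:: c, a & q] j) ->
      nth c [:: c, a & q] j = next [:: c, a & q] (nth c [:: c, a & q] i) \/
      nth c [:: c, a & q] i = next [:: c, a & q] (nth c [:: c, a & q] j).
    move=> ij jq /(chord _ _ ij jq)[->|[-> ->]].
      by left; rewrite nextE // (ltn_trans ij).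
    by right; rewrite nextE //= nth_default.
  move=> x y /(nthP c)[i iq <-] /(nthP c)[j jq <-].
  case: (ltngtP i j) => [ij|ij|->]; last by rewrite adj_irr.
    exact: main.
  by rewrite adj_sym => /(main _ _ ij iq)[]; [right|left].
have := chG _ cyc; case: q q0 aq cq qp {minq aNq cNq uq us chord cyc} => [|b []] //=.
move=> _ /andP[ab _] cb qp _; apply: noT; exists b; split=> //.
by apply: qp; rewrite inE.
Qed.
End InducedCycle.

(** * The metric of a chordal graph *)

Section ChordalMetric.
Variables (V : choiceType) (G : graph V).
Hypothesis chordalG : chordal G.
Implicit Types (u v w x y z : V).

(** If [y <> z], join them by a walk that stays closer to [x] in between. Its
    inner vertices are too close to [x] to be adjacent to [c], so the triangle on
    the edge [c y] can only have [z] as its apex. *)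
Lemma chordal_clique c x y z n : dist G c x = n.+1 -> G c y -> G c z ->
  dist G y x = n -> dist G z x = n -> y = z \/ G y z.
Proof.
move=> cx cy cz yx zx; case: (eqVneq y z) => [|yz]; [by left|right].
have [p [yp pz below]] : exists p, [/\ path G y p, last y p = z &
  {in p, forall t, t = z \/ dist G t x < n}] by apply: walk_below; lia.
have [||||t [tp yt ct]] := chordal_common_neighbor chordalG cy yp.
- by rewrite pz.
- by apply/negP => /below[/eqP|]; [rewrite (negPf yz)|rewrite yx ltnn].
- apply/negP => /below[cz'|]; last by rewrite cx; lia.
  by rewrite cz' adj_irr in cz.
- by apply: contraNneq yz => p0; rewrite -pz p0.
case: (below t tp) => [<- //|].
by have [] := dist_adj_le x ct; rewrite cx; lia.
Qed.

(** Close the edge [y z] by a walk from [z] to a neighbor of [y] nearer to [x];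
    the apex of the triangle is on that walk, all of which is below [y] and [z]. *)
Lemma chordal_triangle x y z n : G y z ->
  dist G y x = n.+1 -> dist G z x = n.+1 ->
  exists t, [/\ G y t, G z t & dist G t x = n].
Proof.
move=> yz yx zx; have [y' yy' y'x] := dist_step yx.
have [p [zp pl below]] : exists p, [/\ path G z p, last z p = y' &
  {in p, forall t, t = y' \/ dist G t x < n.+1}] by apply: walk_below; lia.
have le t : t \in p -> dist G t x <= n by case/below => [->|]; lia.
have [||||t [tp zt yt]] := chordal_common_neighbor chordalG yz zp.
- by rewrite pl.
- by apply/negP => /le; rewrite zx ltnn.
- by apply/negP => /le; rewrite yx ltnn.
- by apply/eqP => p0; move: pl zx; rewrite p0 /= => ->; lia.
exists t; split=> //; have := le t tp.
by have [] := dist_adj_le x yt; rewrite yx; lia.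
Qed.

(** The walk from [w1] through [p1] to [p2] closes up with [w2]. Its vertices
    strictly closer to [v] than [p1] are not adjacent to [w2], so the triangle on
    the edge [w1 w2] has [p1] or [p2] as its apex. *)
Lemma chordal_crossing v w1 w2 p1 p2 n : w1 = w2 \/ G w1 w2 ->
  dist G w1 v = n.+1 -> dist G w2 v = n.+1 ->
  dist G p1 v = n -> dist G p2 v = n -> G w1 p1 -> G w2 p2 ->
  G w1 p2 \/ G w2 p1.
Proof.
move=> [->|w12] d1 d2 e1 e2 wp1 wp2; first by left.
case: (boolP (G w2 p1)) => [|N21]; [by right|left].
have [r [pr rl below]] : exists r, [/\ path G p1 r, last p1 r = p2 &
  {in r, forall t, t = p2 \/ dist G t v < n}] by apply: walk_below; lia.
have le t : t \in p1 :: r -> dist G t v <= n.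
  by rewrite inE => /predU1P[->|/below[->|]]; lia.
have wr : path G w1 (p1 :: r) by rewrite /= wp1.
rewrite adj_sym in w12.
have [||||t [tr w1t w2t]] := chordal_common_neighbor chordalG w12 wr.
- by rewrite /= rl.
- by apply/negP => /le; rewrite d1 ltnn.
- by apply/negP => /le; rewrite d2 ltnn.
- by [].
move: tr; rewrite inE => /predU1P[t1|/below[<- //|tv]].
  by rewrite -t1 w2t in N21.
by have [] := dist_adj_le v w2t; rewrite d2; lia.
Qed.

(** Walk from [w] to [v], on to [x] and back to [u] along geodesics. The apex of
    a triangle on the edge [u w] cannot lie on the first leg, which is too far
    from [u], nor on the last, which is too far from [w]; on the middle leg it is
    at distance at least [m] from [v] and at least [j] from [x]. *)
Lemma chordal_edge_separates u v w x j m : G u w ->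
  dist G w v = m -> dist G u v = m.+1 ->
  dist G u x = j -> dist G w x = j.+1 -> j + m <= dist G v x.
Proof.
move=> uw wv uv ux wx; rewrite leqNgt; apply/negP => vx.
case: j ux wx vx => [|j] ux wx vx.
  by move: uv; rewrite (dist_eq0 ux) dist_sym; lia.
have [u' uu' u'x] := dist_step ux.
have [p1 [wp1 l1 s1]] := geodesic G w v.
have [p2 [vp2 l2 s2]] := geodesic G v x.
have [p3 [xp3 l3 s3]] := geodesic G x u'.
have m1 t : t \in p1 -> dist G t v < m.
  move=> /(geodesic_mem wp1); rewrite l1 => /(_ s1)[tw].
  case: (posnP (dist G w t)) => [/dist_eq0 wt|]; last by lia.
  by rewrite wt eqxx in tw.
have m2 t : t \in p2 -> dist G t v + dist G t x < j.+1 + m.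
  move=> /(geodesic_mem vp2); rewrite l2 => /(_ s2)[_].
  by rewrite [dist G v t]dist_sym; lia.
have m3 t : t \in p3 -> dist G t x <= j.
  move=> /(geodesic_mem xp3); rewrite l3 => /(_ s3)[_].
  by rewrite [dist G x t]dist_sym s3 [dist G x u']dist_sym u'x; lia.
have pw : path G w (p1 ++ p2 ++ p3).
  by rewrite !cat_path wp1 l1 vp2 l2 xp3.
have mem t : t \in p1 ++ p2 ++ p3 ->
    [\/ dist G t v < m, dist G t v + dist G t x < j.+1 + m | dist G t x <= j].
  rewrite !mem_cat => /or3P[/m1|/m2|/m3] h; [exact: Or31|exact: Or32|exact: Or33].
have [||||t [/mem tp wt ut]] := chordal_common_neighbor chordalG uw pw.
- by rewrite !last_cat l1 l2 l3.
- by apply/negP => /mem; rewrite wv wx => -[]; lia.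
- by apply/negP => /mem; rewrite uv ux => -[]; lia.
- apply/eqP => p0; have : last w (p1 ++ p2 ++ p3) = u' by rewrite !last_cat l1 l2 l3.
  by rewrite p0 /= => wu'; rewrite wu' in wx; lia.
have [_ h1] := dist_adj_le v ut; have [_ h2] := dist_adj_le x wt.
have [h3 _] := dist_adj_le v ut; have [h4 _] := dist_adj_le x wt.
by case: tp; lia.
Qed.

(** The rungs are edges [a q], with [a] descending a geodesic to [u] that
    continues to a geodesic to [x]. By [chordal_triangle] and [chordal_clique]
    each rung yields the next one down. The other end [q] drifts away from [v] by
    at most one per rung; this keeps it different from [a], as otherwise [u] would
    be closer to [v] than it is. *)
Lemma chordal_ladder u v x i a q : G a q ->
  dist G a x = dist G u x + i -> dist G q x = dist G u x + i ->
  dist G a u = i -> dist G q v + i < dist G u v ->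
  exists s, [/\ G u s, dist G s x = dist G u x & dist G s v < dist G u v].
Proof.
elim: i a q => [|i IHi] a q aq ax qx au qv.
  rewrite (dist_eq0 au) in aq; exists q.
  by split=> //; [rewrite qx addn0|lia].
have [b ab bu] := dist_step au.
have [r [ar qr rx]] := chordal_triangle aq (etrans ax (addnS _ _)) (etrans qx (addnS _ _)).
have bx : dist G b x = dist G u x + i.
  by have := dist_triangle G u b x; have [] := dist_adj_le x ab; lia.
have rv : dist G r v <= (dist G q v).+1 by have [_] := dist_adj_le v qr.
have [br|br] : b = r \/ G b r.
- by apply: (chordal_clique (etrans ax (addnS _ _)) ab ar).
- have := dist_triangle G b u v; rewrite [dist G u b]dist_sym bu br; lia.
- by apply: IHi br bx rx bu _; lia.
Qed.

(** The descending neighbors of [u] are pairwise adjacent, so by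
    [chordal_crossing] the sets of them adjacent to two vertices [y] and [y'] of
    the next level are nested, and the larger set serves all the [x] that either
    serves. A finite list is necessary: in an infinite graph these nested sets
    may increase forever. *)
Lemma chordal_common_descent u v n (X : seq V) : dist G u v = n.+2 ->
  exists y, [/\ dist G y v = n, dist G u y <= 2 &
    {in X, forall x, (exists s,
         [/\ G u s, dist G s v = n.+1 & dist G s x <= dist G u x]) ->
       exists s,
         [/\ G u s, dist G s v = n.+1, dist G s x <= dist G u x & G s y]}].
Proof.
move=> uv; elim: X => [|x X [y [yv uy IHX]]].
  have [w uw wv] := dist_step uv; have [y wy yv] := dist_step wv.
  exists y; split=> //; rewrite (leq_trans (dist_triangle G w u y)) //.
  by rewrite (dist_adj uw) (dist_adj wy).
case: (pselect (exists s,
    [/\ G u s, dist G s v = n.+1 & dist G s x <= dist G u x])); last first.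
  move=> none; exists y; split=> // x'; rewrite inE => /predU1P[-> //|].
  exact: IHX.
move=> [s [us sv sx]]; have [y' sy' y'v] := dist_step sv.
case: (boolP (G s y)) => [sy|Nsy].
  exists y; split=> // x'; rewrite inE => /predU1P[-> _|]; last exact: IHX.
  by exists s.
exists y'; split=> //.
  rewrite (leq_trans (dist_triangle G s u y')) //.
  by rewrite (dist_adj us) (dist_adj sy').
move=> x'; rewrite inE => /predU1P[-> _|x'X /(IHX _ x'X)[t [ut tv tx' ty]]].
  by exists s.
exists t; split=> //.
have [//|sy] := chordal_crossing (chordal_clique uv ut us tv sv) tv sv yv y'v ty sy'.
by rewrite sy in Nsy.
Qed.

(** If [x] violates the last condition, [chordal_ladder] gives a neighbor of [u]
    as in [chordal_common_descent], hence a path from near [x] through [y] to [p]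
    that is too short for this. *)
Lemma chordal_last_step u v n (X : seq V) : dist G u v = n.+3 ->
  exists p, [/\ G v p, dist G p u = n.+2 &
    {in X, forall x, dist G u x + n.+2 <= dist G v x ->
       dist G p x < dist G v x}].
Proof.
move=> uv; have [y [yv uy yX]] := chordal_common_descent X uv.
have [p vp py] : exists2 p, G v p & dist G p y = n.
  by apply: dist_step; rewrite dist_sym.
have pv := dist_adj vp; rewrite dist_sym in pv.
have pu : dist G p u = n.+2.
  have := dist_triangle G p u v; have := dist_triangle G y p u.
  by rewrite [dist G y u]dist_sym [dist G u p]dist_sym; lia.
exists p; split=> // x xX far; rewrite ltnNge; apply/negP => px.
have px' : dist G p x = dist G u x + n.+2.
  by have := dist_triangle G u p x; have [_] := dist_adj_le x vp; lia.
have vx : dist G v x = dist G u x + n.+2 by lia.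
rewrite adj_sym in vp.
have [|s [us sx sv]] := @chordal_ladder u v x n.+2 p v vp px' vx pu.
  by rewrite distxx uv.
have [|t [_ _ tx ty]] := yX x xX.
  by exists s; split; rewrite ?sx //; have [] := dist_adj_le v us; lia.
have := dist_triangle G y p x; have [] := dist_adj_le x ty.
have := dist_adj ty.
lia.
Qed.
End ChordalMetric.

(** * Medians *)

Section MedianFunction.
Variables (R : realType) (V : choiceType) (G : graph V) (pi : profile R V).
Local Open Scope ring_scope.

(** One enumeration for all vertices at once: the enumeration hidden in [F]
    depends on the vertex, as the term of a weighted vertex vanishes there. *)
Lemma F_seq : exists r : seq V, forall x,
  F G pi x = \sum_(u <- r) pi u * (dist G u x)%:R.
Proof.
exists (finmap.enum_fset (fset_set [set u | pi u != 0]%classic)) => x.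
rewrite /F (fsbigE (finmap.enum_fset (fset_set [set u | pi u != 0]%classic))) //.
- by apply: eq_bigl => u; rewrite in_setT.
- move=> u _; rewrite in_fset_set; last exact: weight_fin.
  by rewrite notin_setE /= => /negP; rewrite negbK => /eqP ->; rewrite mul0r.
Qed.

(** The vertices that are no worse than [x0] realise finitely many vectors of
    distances to the weighted vertices; a cheapest realised vector is a median. *)
Lemma Med_nonempty : (Med G pi !=set0)%classic.
Proof.
have [x0 _] := (adj_connected G).1.
have [r0 Fr0] := F_seq.
have {r0 Fr0} [r Fr r0] : exists2 r : seq V,
    forall x, F G pi x = \sum_(u <- r) pi u * (dist G u x)%:R &
    {in r, forall u, 0 < pi u}.
  exists [seq u <- r0 | pi u != 0].
    move=> x; rewrite Fr0 big_filter [RHS]big_mkcond; apply: eq_bigr => u _.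
    by case: ifPn => //; rewrite negbK => /eqP ->; rewrite mul0r.
  by move=> u; rewrite mem_filter => /andP[u0 _]; rewrite lt0r u0 weight_ge0.
pose n := size r; pose e (i : 'I_n) := tnth (in_tuple r) i.
have Fe x : F G pi x = \sum_(i < n) pi (e i) * (dist G (e i) x)%:R.
  by rewrite Fr (big_tnth _ _ r).
have pos i : 0 < pi (e i) by apply: r0; apply: mem_tnth.
(* [F G pi x0] bounds each term, hence the distance to each weighted vertex. *)
pose N := (\max_(i < n) Num.bound (F G pi x0 / pi (e i)))%N.
have F_ge0 x : 0 <= F G pi x.
  by rewrite Fe sumr_ge0 // => i _; rewrite mulr_ge0 ?ler0n // ltW.
have bounded x i : F G pi x <= F G pi x0 -> (dist G (e i) x < N.+1)%N.
  move=> Fx; rewrite ltnS (leq_trans _ (leq_bigmax i)) //.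
  rewrite -(ler_nat R) ltW //.
  apply: le_lt_trans (archi_boundP _); last by rewrite divr_ge0 // ltW.
  rewrite ler_pdivlMr // mulrC (le_trans _ Fx) // Fe (bigD1 i) //= lerDl.
  by rewrite sumr_ge0 // => k _; rewrite mulr_ge0 ?ler0n // ltW.
pose realised (h : {ffun 'I_n -> 'I_N.+1}) :=
  `[< exists x, forall i, dist G (e i) x = h i >].
pose cost (h : {ffun 'I_n -> 'I_N.+1}) : R := \sum_(i < n) pi (e i) * (h i)%:R.
pose code x : {ffun 'I_n -> 'I_N.+1} := [ffun i => inord (dist G (e i) x)].
have codeE x : F G pi x <= F G pi x0 -> forall i, dist G (e i) x = code x i.
  by move=> Fx i; rewrite ffunE inordK // bounded.
have cost_code x : F G pi x <= F G pi x0 -> cost (code x) = F G pi x.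
  by move=> Fx; rewrite Fe; apply: eq_bigr => i _; rewrite -codeE.
have code0 : realised (code x0) by apply/asboolP; exists x0; apply: codeE.
case: (Order.TotalTheory.arg_minP cost code0) => h /asboolP[m mh] hmin.
have Fm : F G pi m = cost h by rewrite Fe; apply: eq_bigr => i _; rewrite mh.
have Fm0 : F G pi m <= F G pi x0.
  by rewrite Fm -(cost_code x0) // hmin.
exists m => y; case: (leP (F G pi y) (F G pi x0)) => Fy; last first.
  by rewrite (le_trans Fm0) // ltW.
rewrite Fm -(cost_code y) // hmin //; apply/asboolP; exists y; exact: codeE.
Qed.

Hypothesis chordalG : chordal G.

(** [chordal_last_step] is applied from both ends, so that whenever [w] or [p]
    loses one unit of distance to [x], the other gains one. *)
Lemma Med_step u v n : Med G pi u -> Med G pi v -> dist G u v = n.+3 ->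
  exists w, [/\ Med G pi w, G u w & dist G w v = n.+2].
Proof.
move=> Mu Mv uv; have [r Fr] := F_seq.
have vu : dist G v u = n.+3 by rewrite dist_sym.
have [w [uw wv wr]] := chordal_last_step chordalG r vu.
have [p [vp pu pr]] := chordal_last_step chordalG r uv.
have Fwp : F G pi w + F G pi p <= F G pi u + F G pi v.
  rewrite !Fr -!big_split /= !(big_seq_cond predT) ler_sum // => x /andP[xr _].
  rewrite -!mulrDr ler_wpM2l ?weight_ge0 // -!natrD ler_nat.
  rewrite ![dist G x _]dist_sym.
  have [_ wu] := dist_adj_le x uw; have [_ pv] := dist_adj_le x vp.
  have uwx : (dist G w x = (dist G u x).+1 -> dist G p x < dist G v x)%N.
    move=> wx; apply: pr => //.
    exact: chordal_edge_separates uw wv uv erefl wx.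
  have vpx : (dist G p x = (dist G v x).+1 -> dist G w x < dist G u x)%N.
    move=> px; apply: wr => //.
    exact: chordal_edge_separates vp pu vu erefl px.
  by lia.
exists w; split=> // y; apply: le_trans (Mu y).
by rewrite -(lerD2r (F G pi p)) (le_trans Fwp) // lerD2l Mv.
Qed.

End MedianFunction.

(** Medians at distance at most [2] are equal or adjacent in the square; from
    farther apart, [Med_step] brings one of them closer to the other. *)
Theorem corollary46 (R : realType) (V : choiceType) (G : graph V)
    (chordalG : chordal G) : square_connected_medians R G.
Proof.
move=> pi; split=> [|u v Mu Mv]; first exact: Med_nonempty.
have [n] := ubnP (dist G u v); elim: n u Mu => // n IHn u Mu.
case: (ltnP 2 (dist G u v)) => [far|near] uvn; last first.
  case: (eqVneq u v) => [<-|uv]; first by exists [::].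
  exists [:: v]; split=> //=; first by rewrite /square uv near.
  by move=> z; rewrite inE => /eqP ->.
have [w [Mw uw wv]] : exists w, [/\ Med G pi w, G u w & dist G w v < dist G u v].
  case E: (dist G u v) far => [|[|[|k]]] // _.
  have [w [Mw uw wv]] := Med_step chordalG Mu Mv E.
  by exists w; split; rewrite ?wv.
have [|p [wp pv pM]] := IHn w Mw; first by lia.
exists (w :: p); split=> //=.
  rewrite wp andbT /square (dist_adj uw) andbT.
  by apply: contraTneq uw => ->; rewrite adj_irr.
by move=> z; rewrite inE => /predU1P[->|/pM].
Qed.
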